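(* Assume the standing hypotheses (F0), (F1), (F2), (K), (G), Scenario 1 and (P1) stated in the context, with $r>1$. Fix $\nu\ge\nu_0$ and $\tau\in[b_0,b_1]$, and let $\tilde c=2\sup\{\|\dot\gamma^+(t)\|,\|\dot\gamma^-(s)\|: s<0<t\}$. Consider increasing sequences $\mathcal T^+=(T_j)_{j\in\mathbb Z^+}$, $\mathcal T^-=(T_j)_{j\in\mathbb Z^-}$ satisfying (M), $\mathcal M(T_{2j})=0$ for all $j$, $T_{j+1}-T_j>\Lambda^1+K_0(1+\nu)|\ln\varepsilon|$ for $j\ge1$ and for $j\le-2$, $T_1-b_1>\Lambda^1+K_0(1+\nu)|\ln\varepsilon|$ and $b_0-T_{-1}>\Lambda^1+K_0(1+\nu)|\ln\varepsilon|$. It is known (see the context) that for $0<\varepsilon\le\varepsilon_0$, with $\varepsilon_0$ small, there are $c^*>0$ and, for all $e^\pm\in\{0,1\}^{\mathbb Z^\pm}$, non-empty compact sets $X^\pm(e^\pm,\tau,\mathcal T^\pm)$ and sequences $\alpha_j(\varepsilon)$ such that every $\xi\in X^+$ (respectively $\xi\in X^-$) has the property $C^+_{e^+}$ (respectively $C^-_{e^-}$), with $|\alpha_j(\varepsilon)|\le c_\alpha\varepsilon$ if (N) holds and $r\ge2$, and $|\alpha_j(\varepsilon)|\le\omega_\alpha(\varepsilon)$ if (I) holds and $r>1$. Then in $C^+_{e^+}$ and $C^-_{e^-}$ the estimate for the indices $j$ with $e_j=1$ can be replaced as follows. (a) If (N) holds and $r\ge2$: for every $j\in\mathbb Z^\pm$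 with $e_j=1$ and every $\xi\in X^\pm$, $$\|x(t,\tau;\xi)-\gamma(t-T_{2j})\|\le\tilde c^*\varepsilon\quad\text{for } t\in[T_{2j-1},T_{2j+1}],\qquad \tilde c^*=c^*+\tilde c\,c_\alpha .$$ (b) If (I) holds and $r>1$: for every $j\in\mathbb Z^\pm$ with $e_j=1$ and every $\xi\in X^\pm$, $$\|x(t,\tau;\xi)-\gamma(t-T_{2j})\|\le\omega(\varepsilon)\quad\text{for } t\in[T_{2j-1},T_{2j+1}],\qquad \omega(\varepsilon)=c^*\varepsilon+\tilde c\,\omega_\alpha(\varepsilon).$$
   Context: System. Let $r>1$, $\Omega\subset\mathbb R^2$ open, $G\in C^r_b(\Omega,\mathbb R)$ with $0$ a regular value, $\Omega^\pm=\{x\in\Omega:\pm G(x)>0\}$, $\Omega^0=\{x\in\Omega:G(x)=0\}$, $f^\pm\in C^r_b(\Omega^\pm\cup\Omega^0,\mathbb R^2)$, $g\in C^r_b(\mathbb R\times\Omega\times\mathbb R,\mathbb R^2)$. ($C^r_b$: derivatives up to order $r$ bounded and uniformly continuous if $r\in\mathbb N$; if $r=r_0+r_1$ with $r_0\in\mathbb N$, $0<r_1<1$, the same up to order $r_0$, with $r_1$-Hölder derivatives of order $r_0$.) Consider $$(PS)\qquad \dot x=f^\pm(x)+\varepsilon g(t,x,\varepsilon),\quad x\in\Omega^\pm .$$ A solution is a continuous, piecewise $C^r$ function satisfying the corresponding equation whenever it is in $\Omega^\pm$; if $x(t_0)\in\Omega^0$, then $x(t)$ lies in one of $\Omega^+,\Omega^-$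 for $t$ in a left (respectively right) punctured neighbourhood of $t_0$ and its left (right) derivative at $t_0$ is given by the corresponding vector field (no sliding solutions). $x(t,\tau;P)$ is the solution with $x(\tau,\tau;P)=P$. $\|\cdot\|$ is the Euclidean norm, $^*$ on vectors is transposition, $B(A,\rho)$ the $\rho$-neighbourhood of $A$. (F0) $0\in\Omega^0$, $f^\pm(0)=0$, the Jacobian $f^\pm_x(0)$ has eigenvalues $\lambda_s^\pm<0<\lambda_u^\pm$, with normalized eigenvectors $v_s^\pm,v_u^\pm$. (F1) $\nabla G(0)^*v_u^-<0<\nabla G(0)^*v_u^+$ and $\nabla G(0)^*v_s^-<0<\nabla G(0)^*v_s^+$. (F2) Let $\Pi_u^1,\Pi_u^2$ be the two open sets into which $\mathbb R^2$ is divided by the polyline $\{cv_u^+:c\ge0\}\cup\{cv_u^-:c\ge0\}$; then $v_s^+\in\Pi_u^1$, $v_s^-\in\Pi_u^2$. (K) For $\varepsilon=0$ there is a unique solution $\gamma$ homoclinic to the origin with $\gamma(t)\in\Omega^-$ for $t<0$, $\gamma(0)\in\Omega^0$, $\gamma(t)\in\Omega^+$ for $t>0$; furthermore $\nabla G(\gamma(0))^*f^\pm(\gamma(0))>0$. Also $\dot\gamma/\|\dot\gamma\|\to v_u^-$ as $t\to-\infty$ and $\to-v_s^+$ as $t\to+\infty$. Write $\gamma^-=\gamma|_{(-\infty,0]}$, $\gamma^+=\gamma|_{[0,\infty)}$, $\Gamma=\{\gamma(t):t\in\mathbb R\}\cup\{0\}$; $E^{in}$ is the open set enclosed by $\Gamma$,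 $E^{out}$ the open complement of $E^{in}\cup\Gamma$. Scenario 1: there is $\rho>0$ with $dv_u^+\in E^{out}$ and $dv_s^-\in E^{out}$ for $0<d<\rho$. (G) $g$ is bounded with its derivatives for $t\in\mathbb R$, $x\in B(\Gamma,1)$, $\varepsilon\ge0$, and $g(t,0,\varepsilon)=0$ for all $t\in\mathbb R$, $\varepsilon\ge0$. Constants. $\sigma^{fwd}_+=\frac{|\lambda_s^+|}{\lambda_u^++|\lambda_s^+|}$, $\sigma^{bwd}_-=\frac{\lambda_u^-}{\lambda_u^-+|\lambda_s^-|}$, $\underline\sigma=\min\{\sigma^{fwd}_+,\sigma^{bwd}_-\}$, $\overline\sigma=\max\{\sigma^{fwd}_+,\sigma^{bwd}_-\}$, $\Sigma^{fwd}=\frac{\lambda_u^-+|\lambda_s^+|}{\lambda_u^-(\lambda_u^++|\lambda_s^+|)}$, $\Sigma^{bwd}=\frac{\lambda_u^-+|\lambda_s^+|}{|\lambda_s^+|(\lambda_u^-+|\lambda_s^-|)}$, $\overline\Sigma=\max\{\Sigma^{fwd},\Sigma^{bwd}\}$, $K_0=\frac{3\overline\Sigma}{2\underline\sigma}$, $\nu_0=\max\{3\overline\sigma-1;1\}$. $\mathbb Z^+=\{k\ge1\}$, $\mathbb Z^-=\{k\le-1\}$ in $\mathbb Z$. Melnikov function. With $a\wedge b=a_1b_2-a_2b_1$ and $c_\perp^\pm=\frac{\|\nabla G(\gamma(0))\|}{\nabla G(\gamma(0))^*f^\pm(\gamma(0))}$, $$\mathcal M(\alpha)=c_\perp^-\int_{-\infty}^0e^{-\int_0^t\operatorname{tr}f_x^-(\gamma^-(s))ds}f^-(\gamma(t))\wedge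 g(t+\alpha,\gamma^-(t),0)\,dt+c_\perp^+\int_0^{+\infty}e^{-\int_0^t\operatorname{tr}f_x^+(\gamma^+(s))ds}f^+(\gamma(t))\wedge g(t+\alpha,\gamma^+(t),0)\,dt.$$ (P1) There are $\bar c>0$ and an increasing sequence $(b_i)_{i\in\mathbb Z}$ with $b_{i+1}-b_i\ge1/10$ and $\mathcal M(b_{2i})<-\bar c<0<\bar c<\mathcal M(b_{2i+1})$ for all $i\in\mathbb Z$. Conditions on the times. For a sequence $(T_j)$, $\beta_j=b_{n_j}$ and $\beta_j'=b_{n_j+1}$ are the consecutive terms of $(b_i)$ with $\beta_j<T_j<\beta_j'$. Constants $0<\delta_{\mathcal M}<1$ and $1/2>\Lambda^1>2\Lambda^0\ge0$ (independent of $j$) are fixed. (M): for every $j$ there are $a^\uparrow_j,a^\downarrow_j$ with $\beta_{2j}<a_j^\uparrow<T_{2j}-\Lambda^0\le T_{2j}\le T_{2j}+\Lambda^0<a_j^\downarrow<\beta_{2j}'$, $|\mathcal M(a_j^\uparrow)|=|\mathcal M(a_j^\downarrow)|=\delta_{\mathcal M}\bar c$, $\mathcal M(a_j^\uparrow)\mathcal M(a_j^\downarrow)<0$, $\mathcal M(s)\ne0$ for $s\in[a_j^\uparrow,a_j^\downarrow]\setminus[T_{2j}-\Lambda^0,T_{2j}+\Lambda^0]$, and $0<a_j^\downarrow-a_j^\uparrow\le\Lambda^1$. (I): (M) holds with $\Lambda^0=0$ and, for a fixed strictly increasing continuous $\omega_M:[0,\Lambda^1]\to[0,\infty)$ with $\omega_M(0)=0$,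 $|\mathcal M(T_{2j}+h)|\ge\omega_M(|h|)$ whenever $h\neq0$ and $T_{2j}+h\in[a_j^\uparrow,a_j^\downarrow]$, for all $j$. (N): for a fixed $C>0$, $\mathcal M(T_{2j})=0$ and $|\mathcal M'(T_{2j})|>C$ for all $j$ (in this case (M) and (I) hold and one takes $\Lambda^0=0$, $\omega_M(h)=\frac C2h$, $\Lambda^1=\frac{2\bar c}{C}\delta_{\mathcal M}<\frac12$). Properties. $C^+_{e^+}$ for $\xi$: for all $j\in\mathbb Z^+$, if $e_j=1$ then $\|x(t,\tau;\xi)-\gamma(t-T_{2j}-\alpha_j(\varepsilon))\|\le c^*\varepsilon$ on $[T_{2j-1},T_{2j+1}]$; if $e_j=0$ then $\|x(t,\tau;\xi)\|\le c^*\varepsilon$ on $[T_{2j-1},T_{2j+1}]$; and $\|x(t,\tau;\xi)-\gamma(t-\tau)\|\le c^*\varepsilon$ on $[\tau,T_1]$. $C^-_{e^-}$: the same for all $j\in\mathbb Z^-$, with the last interval replaced by $[T_{-1},\tau]$. The existence of the sets $X^\pm$, sequences $\alpha_j$, constants $\varepsilon_0,c^*,c_\alpha>0$ and increasing continuous $\omega_\alpha$ with $\omega_\alpha(0)=0$ (all independent of $\varepsilon,\nu,\tau,\mathcal T^\pm,e^\pm$), as recalled in the claim, is the content of two preceding theorems of the paper. *)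

(* Defs.v *)
From HB Require Import structures.
From mathcomp Require Import all_boot all_order all_algebra.
From mathcomp Require Import all_classical all_reals all_analysis.
Import Order.TTheory GRing.Theory Num.Theory.
Import numFieldNormedType.Exports.

Set Implicit Arguments.
Unset Strict Implicit.
Unset Printing Implicit Defensive.

Local Open Scope classical_set_scope.
Local Open Scope ring_scope.

Section Generalities.
Context {R : realType}.

Definition dot n (u v : 'rV[R]_n) : R := \sum_i u 0 i * v 0 i.

(* The library norm on 'rV_n is the sup norm, hence a separate definition. *)
Definition enorm n (u : 'rV[R]_n) : R := Num.sqrt (dot u u).

Definition wedge (a b : 'rV[R]_2) : R :=
  a 0 0 * b 0 1 - a 0 1 * b 0 0.

Definition grad n (h : 'rV[R]_n -> R) (x : 'rV[R]_n) : 'rV[R]_n :=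
  \row_i 'D_(delta_mx 0 i) h x.

Definition iter_derive (V W : normedModType R) (h : V -> W) (vs : seq V) :
    V -> W :=
  foldr (fun v k => fun x => 'D_v k x) h vs.

(* [Crb r A h]: h is of class C^r_b on A, with r = r0 + r1, r0 the integer part
   of r and 0 <= r1 < 1.  In finite dimension it is enough to control iterated
   directional derivatives along arbitrary fixed directions.  The set A need
   not be open, but is contained in the closure of its interior: since the
   derivatives are uniformly continuous on the interior, they have unique
   continuous extensions to A, with the same bounds and Hoelder constants. *)
Definition Crb (r : R) (V W : normedModType R) (A : set V) (h : V -> W) :=
  let r0 := Num.truncn r in
  let r1 := r - r0%:R in
  [/\ {within A, continuous h},
      forall vs v x, (size vs < r0)%N -> A° x ->
        derivable (iter_derive h vs) x v,
      forall vs, (size vs <= r0)%N ->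
        exists c, forall x, A° x -> `|iter_derive h vs x| <= c,
      forall vs, (size vs <= r0)%N ->
        forall e, 0 < e -> exists2 d, 0 < d &
          forall x y, A° x -> A° y -> `|x - y| < d ->
            `|iter_derive h vs x - iter_derive h vs y| < e
    & 0 < r1 -> forall vs, size vs = r0 ->
        exists c, forall x y, A° x -> A° y ->
          `|iter_derive h vs x - iter_derive h vs y| <= c * `|x - y| `^ r1].

(* Derivative of x at t along J \ {t}: one-sided at an endpoint of J.  If t is
   not a limit point of J \ {t}, the filter is trivial and nothing is required. *)
Definition deriv_along (W : normedModType R) (J : set R) (x : R -> W) (t : R)
    (v : W) :=
  (s - t)^-1 *: (x s - x t) @[s --> within (J `\ t) (nbhs t)] --> v.

Definition piecewise_Cr (r : R) (W : normedModType R) (J : set R) (x : R -> W) :=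
  exists B : set R,
    (forall a b, finite_set (B `&` `[a, b])) /\
    (forall a b, a < b -> `[a, b] `<=` J ->
       (forall t, a < t < b -> ~ B t) -> Crb r `[a, b] x).

Definition oriented_integral (a b : R) (h : R -> R) : R :=
  if a <= b then \int[lebesgue_measure]_(t in `[a, b]) h t
  else - \int[lebesgue_measure]_(t in `[b, a]) h t.

Definition incr_modulus (a : R) (w : R -> R) :=
  [/\ w 0 = 0, {in `[0, a] &, {homo w : u v / u < v}}
    & {within `[0, a], continuous w}].

End Generalities.

Inductive side := Plus | Minus.

Definition sg (R : realType) (s : side) : R :=
  match s with Plus => 1 | Minus => -1 end.

Definition Zside (s : side) (j : int) : Prop :=
  match s with Plus => 0 < j | Minus => j < 0 end.

Record pws (R : realType) := Pws {
  reg : R;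
  Omega : set 'rV[R]_2;
  Gfun : 'rV[R]_2 -> R;
  fld : side -> 'rV[R]_2 -> 'rV[R]_2;
  pert : R -> 'rV[R]_2 -> R -> 'rV[R]_2
}.

Record saddles (R : realType) := Saddles {
  lam_s : side -> R;
  lam_u : side -> R;
  v_s : side -> 'rV[R]_2;
  v_u : side -> 'rV[R]_2
}.

Section System.
Context {R : realType}.
Local Notation V := 'rV[R]_2.
Variables (S : pws R) (E : saddles R) (gamma : R -> V).
Local Notation G := (Gfun S).
Local Notation f := (fld S).
Local Notation g := (pert S).

Definition Oside (s : side) : set V := [set x | Omega S x /\ 0 < sg R s * G x].
Definition Ozero : set V := [set x | Omega S x /\ G x = 0].

Definition pert3 (z : R * V * R) : V := g z.1.1 z.1.2 z.2.

Definition regularity :=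
  [/\ open (Omega S),
      Crb (reg S) (Omega S) G,
      forall x, Ozero x -> grad G x != 0,
      forall s, Crb (reg S) (Oside s `|` Ozero) (f s)
    & Crb (reg S) (([set: R] `*` Omega S) `*` [set: R]) pert3].

(* The derivative of f^+ (resp. f^-), extended by continuity to Ozero.  With the
   library convention, Jacobian matrices act on row vectors on the right. *)
Definition jac (s : side) (x : V) : 'M[R]_2 :=
  lim (jacobian (f s) y @[y --> within (Oside s) (nbhs x)]).

Definition rhs (eps : R) (s : side) (t : R) (x : V) : V :=
  f s x + eps *: g t x eps.

(* At a time t with x(t) in Ozero: behaviour on a one-sided punctured
   neighbourhood H of t (no condition if t is not a limit point of H). *)
Definition one_sided_motion (eps : R) (H : set R) (x : R -> V) (t : R) :=
  exists s, (\forall u \near within H (nbhs t), Oside s (x u)) /\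
            deriv_along H x t (rhs eps s t (x t)).

Definition solves (eps : R) (J : set R) (x : R -> V) :=
  [/\ forall t, J t -> Omega S (x t),
      {within J, continuous x},
      piecewise_Cr (reg S) J x,
      forall t s, J t -> Oside s (x t) ->
        deriv_along J x t (rhs eps s t (x t))
    & forall t, J t -> Ozero (x t) ->
        one_sided_motion eps (J `&` [set u | u < t]) x t /\
        one_sided_motion eps (J `&` [set u | t < u]) x t].

(* x is the function x(., tau; P) on the interval J *)
Definition is_flow (eps : R) (J : set R) (tau : R) (P : V) (x : R -> V) :=
  [/\ solves eps J x, x tau = P
    & forall y, solves eps J y -> y tau = P -> forall t, J t -> y t = x t].

Definition condF0 :=
  Ozero 0 /\
  forall s, [/\ f s 0 = 0, lam_s E s < 0 < lam_u E s,
                enorm (v_s E s) = 1 /\ enorm (v_u E s) = 1,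
                v_s E s *m jac s 0 = lam_s E s *: v_s E s
              & v_u E s *m jac s 0 = lam_u E s *: v_u E s].

Definition condF1 :=
  dot (grad G 0) (v_u E Minus) < 0 < dot (grad G 0) (v_u E Plus) /\
  dot (grad G 0) (v_s E Minus) < 0 < dot (grad G 0) (v_s E Plus).

Definition polyline : set V := [set x | exists s c, 0 <= c /\ x = c *: v_u E s].

Definition condF2 :=
  exists Pi1 Pi2 : set V,
    [/\ open Pi1 /\ open Pi2, connected Pi1 /\ connected Pi2,
        Pi1 `&` Pi2 = set0, Pi1 `|` Pi2 = ~` polyline
      & Pi1 (v_s E Plus) /\ Pi2 (v_s E Minus)].

Definition homoclinic (x : R -> V) :=
  [/\ solves 0 setT x,
      x t @[t --> -oo] --> (0 : V) /\ x t @[t --> +oo] --> (0 : V),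
      forall t, t < 0 -> Oside Minus (x t),
      Ozero (x 0)
    & forall t, 0 < t -> Oside Plus (x t)].

Definition condK :=
  [/\ homoclinic gamma,
      forall x, homoclinic x -> x =1 gamma,
      forall s, 0 < dot (grad G (gamma 0)) (f s (gamma 0)),
      (enorm (derive1 gamma t))^-1 *: derive1 gamma t @[t --> -oo] --> v_u E Minus
    & (enorm (derive1 gamma t))^-1 *: derive1 gamma t @[t --> +oo] --> - v_s E Plus].

Definition Gam : set V := range gamma `|` [set 0].

(* The open set enclosed by the closed curve Gam: the union of the bounded
   connected components of its complement. *)
Definition Ein : set V :=
  [set x | ~ Gam x /\ bounded_set (connected_component (~` Gam) x)].
Definition Eout : set V := ~` (Ein `|` Gam).

Definition scenario1 :=
  exists2 rho, 0 < rho &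
    forall d, 0 < d < rho -> Eout (d *: v_u E Plus) /\ Eout (d *: v_s E Minus).

Definition condG :=
  (forall vs, (size vs <= Num.truncn (reg S))%N ->
     exists c, forall t x eps, Omega S x ->
       (exists2 y, Gam y & enorm (x - y) < 1) -> 0 <= eps ->
       enorm (iter_derive pert3 vs (t, x, eps)) <= c) /\
  (forall t eps, 0 <= eps -> g t 0 eps = 0).

Definition sigma_fwd : R := `|lam_s E Plus| / (lam_u E Plus + `|lam_s E Plus|).
Definition sigma_bwd : R := lam_u E Minus / (lam_u E Minus + `|lam_s E Minus|).
Definition sigma_low : R := Num.min sigma_fwd sigma_bwd.
Definition sigma_up : R := Num.max sigma_fwd sigma_bwd.
Definition Sigma_fwd : R :=
  (lam_u E Minus + `|lam_s E Plus|) /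
  (lam_u E Minus * (lam_u E Plus + `|lam_s E Plus|)).
Definition Sigma_bwd : R :=
  (lam_u E Minus + `|lam_s E Plus|) /
  (`|lam_s E Plus| * (lam_u E Minus + `|lam_s E Minus|)).
Definition Sigma_up : R := Num.max Sigma_fwd Sigma_bwd.
Definition K0 : R := 3 * Sigma_up / (2 * sigma_low).
Definition nu0 : R := Num.max (3 * sigma_up - 1) 1.

(* Twice the supremum of the speed on the two branches of gamma, the corner
   gamma(0) being excluded. *)
Definition ctilde : R := 2 * sup [set enorm (derive1 gamma t) | t in [set t | t != 0]].

Definition c_perp (s : side) : R :=
  enorm (grad G (gamma 0)) / dot (grad G (gamma 0)) (f s (gamma 0)).

Definition mel_integrand (s : side) (alpha t : R) : R :=
  expR (- oriented_integral 0 t (fun u => \tr (jac s (gamma u)))) *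
  wedge (f s (gamma t)) (g (t + alpha) (gamma t) 0).

Definition Mel (alpha : R) : R :=
  c_perp Minus *
    (\int[lebesgue_measure]_(t in `]-oo, 0]) mel_integrand Minus alpha t) +
  c_perp Plus *
    (\int[lebesgue_measure]_(t in `[0, +oo[) mel_integrand Plus alpha t).

Definition condP1 (b : int -> R) (cbar : R) :=
  [/\ 0 < cbar, {homo b : i j / i < j}, forall i, 1 / 10 <= b (i + 1) - b i
    & forall i, Mel (b (2 * i)) < - cbar /\ cbar < Mel (b (2 * i + 1))].

End System.

(* Constants fixed once and for all in the conditions (M), (I), (N). *)
Record times_data (R : realType) := TimesData {
  b_seq : int -> R;
  cbar : R;
  deltaM : R;
  Lam0 : R;
  Lam1 : R;
  omegaM : R -> R;
  CN : R
}.

Definition times_data_ok (R : realType) (D : times_data R) :=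
  [/\ 0 < deltaM D < 1, 0 <= 2 * Lam0 D < Lam1 D, Lam1 D < 1 / 2,
      incr_modulus (Lam1 D) (omegaM D) & 0 < CN D].

Section Times.
Context {R : realType}.
Local Notation V := 'rV[R]_2.
Variables (S : pws R) (E : saddles R) (gamma : R -> V) (D : times_data R).
Local Notation b := (b_seq D).
Local Notation M := (Mel S gamma).

(* A sequence (T_j) indexed by Z^+ or Z^- is represented by T : int -> R, of
   which only the values at indices in [Zside s] are used; likewise for
   e : int -> bool and alpha : int -> R. *)

Definition M_at (L0 : R) (T : int -> R) (j : int) (aup adn : R) :=
  [/\ exists n, b n < aup /\ adn < b (n + 1),
      aup < T (2 * j) - L0 /\ T (2 * j) + L0 < adn,
      `|M aup| = deltaM D * cbar D /\ `|M adn| = deltaM D * cbar D,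
      M aup * M adn < 0
    & (forall u, aup <= u <= adn ->
         ~~ (T (2 * j) - L0 <= u <= T (2 * j) + L0) -> M u != 0) /\
      0 < adn - aup <= Lam1 D].

Definition condM (s : side) (T : int -> R) :=
  forall j, Zside s j -> exists aup adn, M_at (Lam0 D) T j aup adn.

Definition condI (s : side) (T : int -> R) :=
  Lam0 D = 0 /\
  forall j, Zside s j -> exists aup adn,
    M_at 0 T j aup adn /\
    forall h, h != 0 -> aup <= T (2 * j) + h <= adn ->
      omegaM D `|h| <= `|M (T (2 * j) + h)|.

(* The equalities on Lam0 and Lam1 are the choices of constants made in the
   nondegenerate case. *)
Definition condN (s : side) (T : int -> R) :=
  [/\ Lam0 D = 0, Lam1 D = 2 * cbar D / CN D * deltaM D
    & forall j, Zside s j -> M (T (2 * j)) = 0 /\ CN D < `|derive1 M (T (2 * j))|].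

Definition gap (eps nu : R) : R := Lam1 D + K0 E * (1 + nu) * `|ln eps|.

Definition admissible (eps nu : R) (s : side) (T : int -> R) :=
  [/\ forall i j, Zside s i -> Zside s j -> i < j -> T i < T j,
      condM s T,
      forall j, Zside s j -> M (T (2 * j)) = 0,
      forall j, Zside s j -> Zside s (j + 1) -> gap eps nu < T (j + 1) - T j
    & match s with
      | Plus => gap eps nu < T 1 - b 1
      | Minus => gap eps nu < b 0 - T (-1)
      end].

Definition in_range (eps0 eps nu tau : R) (s : side) (T : int -> R) :=
  [/\ 0 < eps <= eps0, nu0 E <= nu, b 0 <= tau <= b 1 & admissible eps nu s T].

Definition time_axis (s : side) (tau : R) : set R :=
  match s with Plus => `[tau, +oo[ | Minus => `]-oo, tau] end.

Definition first_interval (s : side) (tau : R) (T : int -> R) : set R :=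
  match s with Plus => `[tau, T 1] | Minus => `[T (-1), tau] end.

(* Property C^s_e for xi, where the estimate at the indices j with e_j = 1 is
   ||x(t, tau; xi) - peak j t|| <= eta, and all the other estimates have the
   bound cstar * eps. *)
Definition propC (cstar eps tau : R) (s : side) (T : int -> R) (e : int -> bool)
    (peak : int -> R -> V) (eta : R) (xi : V) :=
  exists x : R -> V,
    [/\ is_flow S eps (time_axis s tau) tau xi x,
        forall j, Zside s j -> e j ->
          forall t, T (2 * j - 1) <= t <= T (2 * j + 1) ->
            enorm (x t - peak j t) <= eta,
        forall j, Zside s j -> ~~ e j ->
          forall t, T (2 * j - 1) <= t <= T (2 * j + 1) ->
            enorm (x t) <= cstar * eps
      & forall t, first_interval s tau T t ->
          enorm (x t - gamma (t - tau)) <= cstar * eps].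

End Times.

(* Main.v *)
(* Off t = 0 the homoclinic orbit satisfies gamma' = f^{+-}(gamma), and f^{+-} is
   bounded, so the supremum in the definition of c~ is finite and the mean value
   inequality on each side of the corner gamma(0) makes gamma Lipschitz with
   constant c~.  Removing the time shift alpha_j thus costs at most
   c~ |alpha_j|. *)

Require Import Defs.
From mathcomp Require Import all_boot all_order all_algebra.
From mathcomp Require Import all_classical all_reals all_analysis.
From mathcomp Require Import lra.
Import Order.TTheory GRing.Theory Num.Theory.
Import numFieldNormedType.Exports.

Local Open Scope classical_set_scope.
Local Open Scope ring_scope.

(** * The Euclidean inner product and norm *)

Section Euclidean.
Context {R : realType} {n : nat}.
Implicit Types u v w : 'rV[R]_n.

Lemma dot_ge0 u : 0 <= dot u u.
Proof. by apply: sumr_ge0 => i _; rewrite -expr2 sqr_ge0. Qed.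

Lemma dotC u v : dot u v = dot v u.
Proof. by apply: eq_bigr => i _; rewrite mulrC. Qed.

Lemma dotDr u v w : dot u (v + w) = dot u v + dot u w.
Proof. by rewrite -big_split; apply: eq_bigr => i _; rewrite mxE mulrDr. Qed.

Lemma dotZr (a : R) u v : dot u (a *: v) = a * dot u v.
Proof. by rewrite mulr_sumr; apply: eq_bigr => i _; rewrite mxE mulrCA. Qed.

Lemma dotNr u v : dot u (- v) = - dot u v.
Proof. by rewrite -scaleN1r dotZr mulN1r. Qed.

Lemma sqr_enorm u : enorm u ^+ 2 = dot u u.
Proof. by rewrite sqr_sqrtr ?dot_ge0. Qed.

Lemma enorm_ge0 u : 0 <= enorm u.
Proof. exact: sqrtr_ge0. Qed.

Lemma enormN u : enorm (- u) = enorm u.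
Proof. by rewrite /enorm dotNr dotC dotNr opprK. Qed.

Lemma enormB u v : enorm (u - v) = enorm (v - u).
Proof. by rewrite -enormN opprB. Qed.

(** Cauchy-Schwarz, from expanding [0 <= dot (a *: u - b *: v) (a *: u - b *: v)] for well-chosen
    scalars [a] and [b]. *)
Lemma dot_le_enorm u v : dot u v <= enorm u * enorm v.
Proof.
have key (a b : R) : 0 <= a ^+ 2 * dot u u + b ^+ 2 * dot v v - 2 * a * b * dot u v.
  have := dot_ge0 (a *: u - b *: v).
  rewrite dotDr dotNr !dotZr ![dot (_ - _) _]dotC !(dotDr, dotNr, dotZr).
  by rewrite (dotC v u) => H; lra.
(* With [d] the inner product and [enorm u = 0], the choice [a = enorm v ^+ 2 + 1], [b = d] gives
   [- d ^+ 2 * (enorm v ^+ 2 + 2) >= 0], so [d = 0]. The case [enorm v = 0] is symmetric. *)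
have [u0|u0] := eqVneq (enorm u) 0.
  have := key (enorm v ^+ 2 + 1) (dot u v).
  rewrite -!sqr_enorm u0; have := enorm_ge0 v; set p := enorm v; set d := dot u v.
  by move=> p0 H; nra.
have [v0|v0] := eqVneq (enorm v) 0.
  have := key (dot u v) (enorm u ^+ 2 + 1).
  rewrite -!sqr_enorm v0; have := enorm_ge0 u; set p := enorm u; set d := dot u v.
  by move=> p0 H; nra.
have up : 0 < enorm u * enorm v.
  by rewrite mulr_gt0 // lt_neqAle eq_sym ?u0 ?v0 enorm_ge0.
(* In the generic case these scalars give Cauchy-Schwarz multiplied by [enorm u * enorm v], which is
   then cancelled. *)
have := key (enorm v) (enorm u).
rewrite -!sqr_enorm => H.
by rewrite -(ler_pM2l up); nra.
Qed.

Lemma enormD u v : enorm (u + v) <= enorm u + enorm v.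
Proof.
rewrite -(@ler_pXn2r _ 2) ?nnegrE ?addr_ge0 ?enorm_ge0 //.
rewrite sqr_enorm dotDr ![dot (_ + _) _]dotC !dotDr sqrrD !sqr_enorm (dotC v u).
by have := dot_le_enorm u v; lra.
Qed.

Lemma enorm_dist_triangle u v w : enorm (u - w) <= enorm (u - v) + enorm (v - w).
Proof. by have := enormD (u - v) (v - w); rewrite subrKA. Qed.

(** Each of the [n] coordinates is bounded by the sup norm. This carries the bounds in [Crb], stated
    in the sup norm, over to [enorm]. *)
Lemma enorm_le_norm u : enorm u <= Num.sqrt n%:R * `|u|.
Proof.
rewrite -[`|u|]ger0_norm // -sqrtr_sqr -sqrtrM // ler_wsqrtr //.
apply: (@le_trans _ _ (\sum_(i < n) `|u| ^+ 2)); last first.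
  by rewrite sumr_const card_ord mulr_natl lexx.
apply: ler_sum => i _; rewrite -expr2 -real_normK ?num_real //.
rewrite lerXn2r ?nnegrE // [leRHS]mx_normrE.
exact: (le_bigmax _ (fun ij : 'I_1 * 'I_n => `|u ij.1 ij.2|) (0, i)).
Qed.

End Euclidean.

(** * Differentiation of curves and the mean value inequality *)

Lemma deriv_along_setT (R : realType) (W : normedModType R) (x : R -> W)
    (t : R) (v : W) :
  deriv_along setT x t v -> is_derive t 1 x v.
Proof.
move=> xv.
have cv : h^-1 *: ((x \o shift t) (h *: (1 : R)) - x t) @[h --> 0^'] --> v.
  (* The substitution [s = h + t] turns the quotient over [s != t] into the usual one over
     [h != 0]. *)
  have sh : h + t @[h --> 0^'] --> within (setT `\ t) (nbhs t).
    move=> A At.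
    have ct : h + t @[h --> (0 : R)] --> t.
      by have := cvgD (@cvg_id _ (nbhs (0 : R))) (cvg_cst t); rewrite add0r; exact.
    have := ct _ At.
    change ((\forall h \near (0 : R), (setT `\ t) (h + t) -> A (h + t)) ->
            (\forall h \near (0 : R), h != 0 -> A (h + t))).
    apply: filterS => h /= hA h0; apply: hA; split => // ht.
    by move/eqP: h0; apply; rewrite -(addrK t h) ht subrr.
  have := cvg_comp _ _ sh xv; apply: cvg_trans; apply: near_eq_cvg.
  by apply: nearW => h; rewrite /= addrK /GRing.scale /= mulr1.
by apply: DeriveDef; [apply/cvg_ex; exists v|exact: cvg_lim].
Qed.

Lemma is_derive_dot (R : realType) (n : nat) (u : 'rV[R]_n)
    (x : R -> 'rV[R]_n) (t : R) (v : 'rV[R]_n) :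
  is_derive t 1 x v -> is_derive t 1 (fun s => dot u (x s)) (dot u v).
Proof.
move=> xv.
have dx : derivable x t 1 by [].
have -> : (fun s => dot u (x s)) = \sum_(i < n) (fun s => u 0 i * x s 0 i).
  by apply/funext => s; rewrite fct_sumE.
apply: is_derive_sum => i.
have -> : u 0 i * v 0 i = u 0 i *: 'D_1 (fun s => x s 0 i) t.
  by rewrite -(@derive_val _ _ _ _ _ _ _ xv) derive_mx // mxE.
by apply: is_deriveZ; apply: DeriveDef => //; have /derivable_mxP := dx; exact.
Qed.

(* Apply the scalar mean value theorem to the projection of [x] on the
   direction [x b - x a]. *)
Lemma enorm_mvt (R : realType) (n : nat) (x : R -> 'rV[R]_n) (a b L : R) :
  a <= b -> {within `[a, b], continuous x} ->
  (forall t, a < t < b -> derivable x t 1 /\ enorm (derive1 x t) <= L) ->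
  enorm (x b - x a) <= L * (b - a).
Proof.
rewrite le_eqVlt => /predU1P[<- _ _|ab cx dx].
  by rewrite !subrr mulr0 /enorm /dot big1 ?sqrtr0 // => i _; rewrite mxE mul0r.
pose u := x b - x a.
have du t : t \in `]a, b[ ->
    is_derive t 1 (fun s => dot u (x s)) (dot u (derive1 x t)).
  rewrite in_itv => /dx[dxt _]; apply: is_derive_dot.
  by rewrite derive1E; exact: DeriveDef.
have cu : {within `[a, b], continuous (fun s => dot u (x s))}.
  have cdot : continuous (dot u).
    apply: continuous_big => [|i _ y]; first exact: add_continuous.
    by apply: (@cvgMl_tmp _ _ (nbhs y)); exact: coord_continuous.
  by move=> t; exact: (continuous_comp (cx t) (cdot _)).
have [c cab] := MVT ab du cu.
move: cab; rewrite in_itv => /dx[_ cL].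
rewrite -dotNr -dotDr -/u -sqr_enorm => uE.
(* The identity [uE] is to be divided by [enorm u]. If that is zero, only [0 <= L] is needed, and it
   follows from the speed bound at [c]. *)
have [u0|u0] := eqVneq (enorm u) 0.
  rewrite u0 mulr_ge0 ?subr_ge0 ?(ltW ab) //.
  exact: le_trans (enorm_ge0 _) cL.
have up : 0 < enorm u by rewrite lt_neqAle eq_sym u0 enorm_ge0.
rewrite -(ler_pM2l up) -expr2 uE mulrA ler_wpM2r ?subr_ge0 ?(ltW ab) //.
by apply: le_trans (dot_le_enorm _ _) _; rewrite ler_wpM2l ?enorm_ge0.
Qed.

(** * Speed bound and Lipschitz estimate for the homoclinic orbit *)

Section Homoclinic.
Context {R : realType}.
Variables (S : pws R) (gamma : R -> 'rV[R]_2).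
Hypothesis hS : regularity S.
Hypothesis hgamma : homoclinic S gamma.

(** [Crb] bounds a field only on the interior of its domain; the sides lie there because [Omega] is
    open and [G] is continuous. *)
Lemma Oside_sub_interior (s : side) :
  Oside S s `<=` (Oside S s `|` Ozero S)°.
Proof.
case: hS => oO [cG _ _ _ _] _ _ _ x [Ox Gx].
have nO : \forall y \near x, Omega S y by exact: open_nbhs_nbhs.
have cx : {for x, continuous (fun y => sg R s * Gfun S y)}.
  move: cG; rewrite continuous_open_subspace // => /(_ x (mem_set Ox)) cG.
  by apply: (@cvgMl_tmp _ _ (nbhs x)); exact: cG.
have nG : \forall y \near x, 0 < sg R s * Gfun S y.
  exact: (cvgr_gt _ cx).
by apply: filterS2 nO nG => y Oy Gy; left; split.
Qed.

Lemma fld_bounded :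
  exists c, forall s x, Oside S s x -> enorm (fld S s x) <= c.
Proof.
case: hS => _ _ _ hf _.
have bd s : exists c, forall x, Oside S s x -> `|fld S s x| <= c.
  (* The empty list of directions selects the bound on the field itself. *)
  case: (hf s) => _ _ /(_ [::] (leq0n _))[c hc] _ _; exists c => x Ox.
  by apply: hc; exact: Oside_sub_interior.
have [cp hp] := bd Plus; have [cm hm] := bd Minus.
exists (Num.sqrt 2%:R * Num.max cp cm) => s x Ox.
apply: le_trans (enorm_le_norm _) _; apply: ler_wpM2l => //.
by rewrite le_max; case: s Ox => [/hp|/hm] ->; rewrite ?orbT.
Qed.

Lemma homoclinic_is_derive (t : R) : t != 0 ->
  exists s, Oside S s (gamma t) /\ is_derive t 1 gamma (fld S s (gamma t)).
Proof.
case: hgamma => -[_ _ _ dg _] _ gm _ gp t0.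
have [s Os] : exists s, Oside S s (gamma t).
  by move: t0; rewrite neq_lt => /orP[/gm|/gp] ?; [exists Minus|exists Plus].
exists s; split => //; apply: deriv_along_setT.
by have := dg t s I Os; rewrite /rhs scale0r addr0.
Qed.

Lemma speed_le_ctilde (t : R) : t != 0 ->
  enorm (derive1 gamma t) <= ctilde gamma.
Proof.
move=> t0; set A := [set enorm (derive1 gamma t) | t in [set t | t != 0]].
have [c hc] := fld_bounded.
(* Boundedness of the fields makes [sup] a genuine upper bound. As speeds are nonnegative, so is
   [sup A], and the factor 2 in [ctilde] only weakens the estimate. *)
have /ub_le_sup/(_ (enorm (derive1 gamma t))) : has_ubound A.
  exists c => _ [u /= u0 <-]; have [s [Os dg]] := homoclinic_is_derive _ u0.
  by rewrite derive1E (@derive_val _ _ _ _ _ _ _ dg); exact: hc.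
rewrite -/(sup A) => H.
have /H : A (enorm (derive1 gamma t)) by exists t.
have := enorm_ge0 (derive1 gamma t); rewrite /ctilde -/A; lra.
Qed.

Lemma ctilde_ge0 : 0 <= ctilde gamma.
Proof. exact: le_trans (enorm_ge0 _) (speed_le_ctilde 1 (oner_neq0 _)). Qed.

Lemma homoclinic_lipschitz (a b : R) :
  enorm (gamma b - gamma a) <= ctilde gamma * `|b - a|.
Proof.
have cg : continuous gamma.
  by case: hgamma => -[_ cg _ _ _] _ _ _ _; apply/continuous_subspace_setT.
(* The corner time 0 may be an endpoint of the interval, but not an interior point. *)
have mvt u v : u <= v -> ~~ (u < 0 < v) ->
    enorm (gamma v - gamma u) <= ctilde gamma * (v - u).
  move=> uv n0; apply: enorm_mvt => // [|t tuv].
    exact: continuous_subspaceT.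
  have t0 : t != 0 by apply: contraNneq n0 => <-.
  have [s [_ dg]] := homoclinic_is_derive _ t0.
  by split; [exact: ex_derive|exact: speed_le_ctilde].
wlog ab : a b / a <= b.
  move=> H; have [/H//|/ltW/H] := leP a b.
  by rewrite enormB distrC.
rewrite ger0_norm ?subr_ge0 //.
(* An interval straddling 0 is cut there; the two lengths [0 - a] and [b - 0] add up to [b - a]. *)
have [/andP[a0 b0]|] := boolP (a < 0 < b); last exact: mvt.
apply: le_trans (enorm_dist_triangle _ (gamma 0) _) _.
have := mvt a 0 (ltW a0); rewrite ltxx andbF => /(_ isT).
have := mvt 0 b (ltW b0); rewrite ltxx => /(_ isT).
lra.
Qed.

End Homoclinic.

(** The same solution [x] serves for both peaks, since only the clause for [e j] involves them;
    there the triangle inequality costs [d]. *)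
Lemma propC_change_peak (R : realType) (S : pws R) (gamma : R -> 'rV[R]_2)
    (cstar eps tau : R) (s : side) (T : int -> R) (e : int -> bool)
    (p q : int -> R -> 'rV[R]_2) (eta d : R) (xi : 'rV[R]_2) :
  (forall j t, Zside s j -> enorm (p j t - q j t) <= d) ->
  propC S gamma cstar eps tau s T e p eta xi ->
  propC S gamma cstar eps tau s T e q (eta + d) xi.
Proof.
move=> pq [x [fx h1 h0 hi]]; exists x; split => // j sj ej t tT.
apply: le_trans (enorm_dist_triangle _ (p j t) _) _.
by apply: lerD; [exact: h1|exact: pq].
Qed.

Theorem corollary3p8 (R : realType)
    (S : pws R) (E : saddles R) (gamma : R -> 'rV[R]_2) (D : times_data R)
    (hr : 1 < reg S) (hS : regularity S)
    (hF0 : condF0 S E) (hF1 : condF1 S E) (hF2 : condF2 E)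
    (hK : condK S E gamma) (hsc1 : scenario1 E gamma) (hG : condG S gamma)
    (hP1 : condP1 S gamma (b_seq D) (cbar D)) (hD : times_data_ok D)
    (* the constants, sets and sequences given by the preceding theorems *)
    (eps0 cstar calpha : R) (walpha : R -> R)
    (X : forall (eps nu tau : R) (s : side) (T : int -> R) (e : int -> bool),
           set 'rV[R]_2)
    (alpha : forall (eps nu tau : R) (s : side) (T : int -> R)
               (e : int -> bool), int -> R)
    (heps0 : 0 < eps0) (hcstar : 0 < cstar) (hcalpha : 0 < calpha)
    (hwalpha : incr_modulus eps0 walpha)
    (hX : forall eps nu tau s T e, in_range S E gamma D eps0 eps nu tau s T ->
       [/\ X eps nu tau s T e !=set0, compact (X eps nu tau s T e)
         & forall xi, X eps nu tau s T e xi ->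
             propC S gamma cstar eps tau s T e
               (fun j t => gamma (t - T (2 * j) - alpha eps nu tau s T e j))
               (cstar * eps) xi])
    (halphaN : forall eps nu tau s T e,
       in_range S E gamma D eps0 eps nu tau s T ->
       condN S gamma D s T -> 2 <= reg S ->
       forall j, Zside s j -> `|alpha eps nu tau s T e j| <= calpha * eps)
    (halphaI : forall eps nu tau s T e,
       in_range S E gamma D eps0 eps nu tau s T ->
       condI S gamma D s T ->
       forall j, Zside s j -> `|alpha eps nu tau s T e j| <= walpha eps) :
  forall eps nu tau s T e, in_range S E gamma D eps0 eps nu tau s T ->
    (condN S gamma D s T -> 2 <= reg S ->
     forall xi, X eps nu tau s T e xi ->
       propC S gamma cstar eps tau s T e
         (fun j t => gamma (t - T (2 * j)))
         ((cstar + ctilde gamma * calpha) * eps) xi) /\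
    (condI S gamma D s T ->
     forall xi, X eps nu tau s T e xi ->
       propC S gamma cstar eps tau s T e
         (fun j t => gamma (t - T (2 * j)))
         (cstar * eps + ctilde gamma * walpha eps) xi).
Proof.
move=> eps nu tau s T e hin.
have [_ _ hXi] := hX _ _ _ _ _ e hin.
have [hom _ _ _ _] := hK.
have shift_le d j t : `|alpha eps nu tau s T e j| <= d ->
    enorm (gamma (t - T (2 * j) - alpha eps nu tau s T e j)
           - gamma (t - T (2 * j))) <= ctilde gamma * d.
  move=> ad; apply: le_trans (homoclinic_lipschitz _ _ hS hom _ _) _.
  by rewrite ler_wpM2l ?(ctilde_ge0 _ _ hS hom) // addrAC subrr add0r normrN.
split=> [hN r2|hI] xi /hXi.
(* The bound is regrouped as [cstar * eps + ctilde gamma * (calpha * eps)], the shape [eta + d]. *)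
- rewrite mulrDl -mulrA; apply: propC_change_peak => j t sj.
  by apply: shift_le; exact: halphaN.
- by apply: propC_change_peak => j t sj; apply: shift_le; exact: halphaI.
Qed.
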